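(* For every $r>0$ there is a constant $c(r)>0$ such that for all $\delta,\delta'\in\mathbb{R}^N$ with $|\delta|<r$ and $|\delta'|<r$, $$d_{\mathrm{Hell}}(\gamma^\delta,\gamma^{\delta'})\le c(r)\,|\delta-\delta'|_\Sigma.$$
   Context: Let $\Omega\subset\mathbb{R}^d$ be a bounded Lipschitz domain and $x_0\in\Omega$. Let $s_*,\overline{s},\psi_i\in L^\infty(\Omega)$ ($i\in\mathbb{N}$) with $s_*\ge 0$, and put $b_i=\|\psi_i\|_{L^\infty(\Omega)}$. Assume there are constants $c>0$ and $p>1$ with $b_i<c\,i^{-p}$ for all $i$. Let $U=\{u=(u_1,u_2,\dots)\in\mathbb{R}^{\mathbb{N}}:\sum_{i=1}^\infty|u_i|b_i<\infty\}$, let $\Theta$ be the restriction to $U$ of the product $\sigma$-algebra $\bigotimes_{i=1}^\infty\mathcal{B}(\mathbb{R})$, and let the prior $\gamma$ be the restriction to $U$ of the product Gaussian measure $\bigotimes_{i=1}^\infty\mathcal{N}(0,1)$; $\gamma(U)=1$. The slowness function is $$s(x,u)=s_*(x)+\exp\Big(\overline{s}(x)+\sum_{i=1}^\infty u_i\psi_i(x)\Big),\qquad u\in U,$$ and $s(\cdot,u)$ is assumed continuous and positive on $\overline\Omega$ for each $u\in U$. For $u\in U$, $T(\cdot,u)$ is the solution of the eikonal equation $|\nabla T(x,u)|=s(x,u)$, $T(x_0,u)=0$, with Soner boundary condition $\nabla T(x,u)\cdot n(x)\ge 0$ on $\partial\Omega$ ($n$ the outward unit normal); it is represented by $$T(x,u)=\inf_{\xi\in\Xi_{x_0}(x)}\int_0^1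 s(\xi(r),u)|\xi'(r)|\,dr,\quad \Xi_{x_0}(x)=\{\xi\in W^{1,\infty}([0,1],\overline\Omega):\xi(0)=x_0,\ \xi(1)=x\}.$$ Fix points $x^1,\dots,x^N\in\overline\Omega$ and define $G(u)=(T(x^1,u),\dots,T(x^N,u))\in\mathbb{R}^N$. Let $\Sigma$ be a positive definite $N\times N$ matrix, $|\cdot|$ the Euclidean norm, $|\cdot|_\Sigma=|\Sigma^{-1/2}\cdot|$, and $\Phi(u,\delta)=\frac12|\delta-G(u)|_\Sigma^2$. The posterior $\gamma^\delta$ is the probability measure on $(U,\Theta)$ with $\frac{d\gamma^\delta}{d\gamma}(u)=Z(\delta)^{-1}\exp(-\Phi(u,\delta))$, $Z(\delta)=\int_U\exp(-\Phi(u,\delta))\,d\gamma(u)$. For probability measures $\mu,\nu$ absolutely continuous with respect to $\gamma$, the Hellinger distance is $$d_{\mathrm{Hell}}(\mu,\nu)^2=\frac12\int_U\Big(\sqrt{\tfrac{d\mu}{d\gamma}}-\sqrt{\tfrac{d\nu}{d\gamma}}\Big)^2d\gamma.$$ *)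

(* Defs.v *)
From HB Require Import structures.
From mathcomp Require Import all_boot all_order all_algebra.
From mathcomp Require Import all_classical all_reals all_analysis.
From mathcomp Require Import measurable_realfun.
Set Implicit Arguments.
Unset Strict Implicit.
Unset Printing Implicit Defensive.
Import Order.TTheory GRing.Theory Num.Theory.
Import numFieldNormedType.Exports.
Local Open Scope classical_set_scope.
Local Open Scope ring_scope.

(* Euclidean norm of row and column vectors; the norm `| _ | that the library
   puts on matrices is the maximum norm. *)
Definition enorm (R : realType) m n (v : 'M[R]_(m, n)) : R :=
  Num.sqrt (\sum_i \sum_j v i j ^+ 2).

Section lebesgue_rV.
Context {R : realType} {d : nat}.
Local Notation V := ('rV[R]_d.+1).

Definition box (ab : V * V) : set V :=
  [set x | forall i, ab.1 0 i < x 0 i < ab.2 0 i].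

Definition box_volume (ab : V * V) : R :=
  \prod_i Num.max 0 (ab.2 0 i - ab.1 0 i).

Definition box_cover (X : set V) : set (nat -> V * V) :=
  [set F | X `<=` \bigcup_k box (F k)].

Definition lebesgue_outer (X : set V) : \bar R :=
  ereal_inf [set (\sum_(k <oo) (box_volume (F k))%:E)%E | F in box_cover X].

Local Open Scope ereal_scope.

Let vol_ge0 ab : 0 <= (box_volume ab)%:E.
Proof. by rewrite lee_fin; apply: prodr_ge0 => i _; rewrite le_max lexx. Qed.

Let lebesgue_outer_ge0 X : 0 <= lebesgue_outer X.
Proof. by apply: le_ereal_inf_tmp => _ [F _ <-]; exact: nneseries_ge0. Qed.

Let lebesgue_outer0 : lebesgue_outer set0 = 0.
Proof.
apply/eqP; rewrite eq_le lebesgue_outer_ge0 andbT.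
apply: ereal_inf_lbound; exists (fun=> (0, 0)%R) => //.
apply: eseries0 => k _ _; rewrite /box_volume big_ord_recl/= mxE subrr.
by rewrite maxxx mul0r.
Qed.

Let le_lebesgue_outer : {homo lebesgue_outer : A B / A `<=` B >-> A <= B}.
Proof.
move=> A B AB; apply/ereal_inf_le_tmp => _ [F BF <-].
by exists F => //; exact: subset_trans AB BF.
Qed.

Let lebesgue_outer_sigma_subadditive : sigma_subadditive lebesgue_outer.
Proof.
move=> A; have [[i ioo]|] := pselect (exists i, lebesgue_outer (A i) = +oo).
  rewrite (eseries_pinfty _ _ ioo) ?leey// => n _.
  by rewrite -ltNye (lt_le_trans _ (lebesgue_outer_ge0 _)).
rewrite -forallNE => Aoo.
suff add2e (e : {posnum R}) : lebesgue_outer (\bigcup_n A n) <=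
    \sum_(i <oo) lebesgue_outer (A i) + e%:num%:E.
  by apply/lee_addgt0Pr => _/posnumP[].
rewrite (le_trans _ (epsilon_trick _ _ _))//; last first.
pose vol ab := (box_volume ab)%:E.
pose P n F := box_cover (A n) F /\
  \sum_(k <oo) vol (F k) <= lebesgue_outer (A n) + (e%:num / (2 ^ n.+1)%:R)%:E.
have [G PG] : {G : nat -> nat -> V * V & forall n, P n (G n)}.
  apply: (@choice _ _ P) => n; rewrite /P /lebesgue_outer.
  set S := (X in ereal_inf X); move infS : (ereal_inf S) => iS.
  case: iS infS => [r Sr|Soo|Soo].
  - have en1 : (0 < e%:num / (2 ^ n.+1)%:R)%R by [].
    have /(lb_ereal_inf_adherent en1) : ereal_inf S \is a fin_num by rewrite Sr.
    move=> [x [B AnB muBx] xS].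
    by exists B; split => //; rewrite /vol muBx -Sr; exact/ltW.
  - by have := Aoo n; rewrite /lebesgue_outer Soo.
  - suff : lbound S 0 by move/le_ereal_inf_tmp; rewrite Soo.
    by move=> /= _ [B AnB <-]; exact: nneseries_ge0.
pose w (ij : nat * nat) := vol (G ij.1 ij.2).
have w_ge0 x : 0 <= w x by exact: vol_ge0.
apply: (@le_trans _ _ (\esum_(i in setT) w i)).
  apply: ereal_inf_lbound => /=.
  have /card_esym/ppcard_eqP[f] := card_nat2.
  exists (fun k => G (f k).1 (f k).2).
    move=> t [i _] /(PG i).1 [j _ Bijt]; exists (f^-1%FUN (i, j)) => //=.
    by rewrite invK ?inE.
  by rewrite -(esum_pred_image w f xpredT) ?[fun=> _]set_true// image_eq.
rewrite (_ : esum _ _ = \sum_(i <oo) \sum_(j <oo ) vol (G i j)); last first.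
  pose J : nat -> set (nat * nat) := fun i => [set (i, j) | j in setT].
  rewrite (_ : setT = \bigcup_k J k); last first.
    by rewrite predeqE => -[a b]; split => // _; exists a => //; exists b.
  rewrite esum_bigcupT /=; last 2 first.
    - apply/trivIsetP => i j _ _ ij.
      rewrite predeqE => -[n m] /=; split => //= -[] [_] _ [<-{n} _].
      by move=> [m' _] [] /esym/eqP; rewrite (negbTE ij).
    - by move=> /= [n m].
  rewrite -(image_id [set: nat]) -fun_true esum_pred_image//; last first.
    by move=> n _; exact: esum_ge0.
  apply: eq_eseriesr => /= j _.
  rewrite -(esum_pred_image w (pair j) predT)//=; last first.
    by move=> ? ? _ _; exact: (@can_inj _ _ _ snd).
  by congr esum; rewrite predeqE => -[a b]; split; move=> [i _ <-]; exists i.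
apply: lee_lim.
- apply: is_cvg_nneseries => n *.
  by apply: nneseries_ge0 => m *; exact: (w_ge0 (n, m)).
- by apply: is_cvg_nneseries => n *; apply: adde_ge0.
- by near=> n; apply: lee_sum => i _; exact: (PG i).2.
Unshelve. all: by end_near. Qed.

HB.instance Definition _ := isOuterMeasure.Build R V lebesgue_outer
  lebesgue_outer0 lebesgue_outer_ge0 le_lebesgue_outer
  lebesgue_outer_sigma_subadditive.

Definition lebesgue_outer_measure : {outer_measure set V -> \bar R} :=
  lebesgue_outer.

(* Lebesgue measure on R^(d+1), on the sigma-algebra of Lebesgue-measurable
   (i.e., Caratheodory-measurable) sets. *)
Definition lebesgue_rV :
    {measure set (caratheodory_type lebesgue_outer_measure) -> \bar R} :=
  (lebesgue_outer_measure : set (caratheodory_type lebesgue_outer_measure) -> _).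

End lebesgue_rV.

Section domain.
Context {R : realType} {d : nat}.
Local Notation V := ('rV[R]_d.+1).
Implicit Types (Omega : set V).

(* First d coordinates of a point of R^(d+1). *)
Definition base_coord (y : V) : 'rV[R]_d :=
  \row_i y 0 (widen_ord (leqnSn d) i).

Definition bounded_lipschitz_domain Omega : Prop :=
  [/\ open Omega, connected Omega, bounded_set Omega &
   forall q, closure Omega q -> ~ Omega q ->
   exists (Q : 'M[R]_d.+1) (rho L : R) (phi : 'rV[R]_d -> R),
   [/\ Q *m Q^T = 1%:M, 0 < rho,
       forall y z, `|phi y - phi z| <= L * enorm (y - z) &
       forall x, enorm (x - q) < rho ->
         let y := (x - q) *m Q in
         Omega x <-> phi (base_coord y) < y 0 ord_max]].

(* Elements of L^oo(Omega) are represented by functions on the whole space of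
   which only the values on Omega matter; (f \_ Omega) is the extension by 0. *)
Definition Linfty Omega (f : V -> R) : Prop :=
  (f \_ Omega) \in Lfun (@lebesgue_rV R d) +oo%E.

Definition Linfty_norm Omega (f : V -> R) : R :=
  fine ('N[@lebesgue_rV R d]_+oo%E[EFin \o (f \_ Omega)])%E.

End domain.

Section travel_time.
Context {R : realType} {d : nat}.
Local Notation V := ('rV[R]_d.+1).
Local Notation lambda := (@lebesgue_measure R).

Definition test_function (phi : R -> R) : Prop :=
  (forall k x, derivable (derive1n k phi) x 1) /\
  exists a b : R, [/\ 0 < a, b < 1 & forall x, ~ (a <= x <= b) -> phi x = 0].

Definition weak_derivative (f g : R -> R) : Prop :=
  forall phi, test_function phi ->
  \int[lambda]_(x in `[0, 1]) (f x * derive1 phi x) =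
  - \int[lambda]_(x in `[0, 1]) (g x * phi x).

(* xi is the continuous representative of an element of W^{1,oo}([0,1]), with
   weak derivative xi'. *)
Definition W1infty (xi xi' : R -> V) : Prop :=
  {within `[0, 1], continuous xi} /\
  forall i, ((fun r => xi' r 0 i) \_ `[0, 1]) \in Lfun lambda +oo%E /\
            weak_derivative (fun r => xi r 0 i) (fun r => xi' r 0 i).

(* Admissible paths from x0 to x, paired with their (a.e. unique) weak
   derivative. *)
Definition paths (Omega : set V) (x0 x : V) : set ((R -> V) * (R -> V)) :=
  [set xi | [/\ W1infty xi.1 xi.2,
                forall r, 0 <= r <= 1 -> closure Omega (xi.1 r),
                xi.1 0 = x0 & xi.1 1 = x]].

(* The solution at x of the eikonal equation |grad T| = sigma, T(x0) = 0, with
   Soner boundary condition, given by its representation formula. *)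
Definition travel_time (Omega : set V) (x0 : V) (sigma : V -> R) (x : V) : R :=
  inf [set \int[lambda]_(r in `[0, 1]) (sigma (xi.1 r) * enorm (xi.2 r))
      | xi in paths Omega x0 x].

End travel_time.

(* R^N with the product sigma-algebra. *)
Definition Rinfty (R : realType) := g_sigma_algebraType
  (\bigcup_i preimage_set_system setT (fun u : nat -> R => u i)
    (measurable : set (set (measurableTypeR R)))).

Definition standard_gaussian_product {R : realType}
    (mu : set (Rinfty R) -> \bar R) : Prop :=
  forall n (A : nat -> set (measurableTypeR R)), (forall i, measurable (A i)) ->
  mu [set u | forall i, (i < n)%N -> A i (u i)] =
  (\prod_(i < n) normal_prob 0 1 (A i))%E.

Section parameter_space.
Context {R : realType} {d : nat}.
Variables (Omega : set 'rV[R]_d.+1) (psi : nat -> 'rV[R]_d.+1 -> R).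

Definition Uset : set (Rinfty R) :=
  [set u | (\sum_(i <oo) (`|u i| * Linfty_norm Omega (psi i))%:E < +oo)%E].

Definition Utype : Type := set_type Uset.

Let Uset0 : ((fun=> 0) : Rinfty R) \in Uset.
Proof.
rewrite inE /Uset /= eseries0// => i _ _.
by rewrite normr0 mul0r.
Qed.

HB.instance Definition _ := Choice.on Utype.
HB.instance Definition _ := isPointed.Build Utype (SigSub Uset0).

Definition Uincl (u : Utype) : Rinfty R := set_val u.

(* U with the trace of the product sigma-algebra. *)
Definition Uspace := g_sigma_algebra_preimageType Uincl.

Definition coeff (u : Uspace) (i : nat) : R := Uincl u i.

Let term_ge0 (u : Rinfty R) i :
  (0 <= (`|u i| * Linfty_norm Omega (psi i))%:E)%E.
Proof. by rewrite lee_fin mulr_ge0// fine_ge0// Lnorm_ge0. Qed.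

Lemma measurable_Uset : measurable Uset.
Proof.
have mc i : measurable_fun setT (fun u : Rinfty R => (u i : measurableTypeR R)).
  move=> _ Y mY; apply: sub_sigma_algebra; exists i => //.
  by exists Y.
pose t i (u : Rinfty R) : \bar R :=
  (`|u i| * Linfty_norm Omega (psi i))%:E.
have mf : measurable_fun [set: Rinfty R]
    (fun u => (\sum_(i <oo) t i u)%E : \bar R).
  apply: ge0_emeasurable_sum => [i u _ _|i _]; first exact: term_ge0.
  apply/measurable_EFinP; apply: measurable_funM => //.
  by apply: measurableT_comp => //; exact: mc.
have := mf measurableT _ (measurableC (emeasurable_set1 +oo%E)).
rewrite setTI; congr measurable; apply/seteqP; split => u /=.
  by move/eqP; rewrite -ltey.
by rewrite /Uset/= ltey => /eqP.
Qed.

Lemma measurable_Uincl (A : set Uspace) : measurable A ->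
  measurable (Uincl @` A).
Proof.
move=> [B mB <-]; rewrite setTI.
rewrite (_ : _ @` _ = B `&` Uset); first exact: measurableI measurable_Uset.
apply/seteqP; split => [_ [u Bu <-]|u [Bu Uu]].
  by split => //; exact: set_valP.
by exists (exist _ u (mem_set Uu)).
Qed.

(* Restriction to U of a measure on R^N. *)
Definition prior (mu : probability (Rinfty R) R) (A : set Uspace) : \bar R :=
  mu (Uincl @` A).

Section prior_measure.
Variable mu : probability (Rinfty R) R.

Let prior0 : prior mu set0 = 0%E.
Proof. by rewrite /prior image_set0 measure0. Qed.

Let prior_ge0 A : (0 <= prior mu A)%E.
Proof. exact: measure_ge0. Qed.

Let prior_sigma_additive : semi_sigma_additive (prior mu).
Proof.
move=> F mF tF mUF; rewrite /prior image_bigcup.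
have iU : injective Uincl by move=> x y /val_inj.
apply: measure_semi_sigma_additive.
- by move=> i; exact: measurable_Uincl.
- apply/trivIsetP => i j _ _ ij; apply/seteqP; split => // x.
  move=> [[u Fu <-] [v Fv /iU vu]].
  have : (F i `&` F j) u by split; [exact: Fu|rewrite -vu].
  by move/trivIsetP : tF => /(_ i j I I ij) ->.
- by rewrite -image_bigcup; exact: measurable_Uincl.
Qed.

HB.instance Definition _ := isMeasure.Build _ _ _ (prior mu)
  prior0 prior_ge0 prior_sigma_additive.

Let prior_fin : fin_num_fun (prior mu).
Proof.
by move=> A mA; apply: fin_num_measure; exact: measurable_Uincl.
Qed.

HB.instance Definition _ := @Measure_isFinite.Build _ _ _ (prior mu) prior_fin.

End prior_measure.

End parameter_space.

Section inverse_problem.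
Context {R : realType}.

Definition posdefmx n (S : 'M[R]_n) : Prop :=
  S^T = S /\ forall v : 'cV[R]_n, v != 0 -> 0 < (v^T *m S *m v) 0 0.

(* The unique positive definite square root of a positive definite matrix. *)
Definition sqrtmx n (S : 'M[R]_n) : 'M[R]_n :=
  get [set A | posdefmx A /\ A *m A = S].

Definition norm_cov n (S : 'M[R]_n) (v : 'cV[R]_n) : R :=
  enorm (invmx (sqrtmx S) *m v).

Context {disp : measure_display} {T : measurableType disp}.

Definition potential n (S : 'M[R]_n) (G : T -> 'cV[R]_n) (u : T)
    (delta : 'cV[R]_n) : R :=
  2^-1 * norm_cov S (delta - G u) ^+ 2.

Variable gamma : {finite_measure set T -> \bar R}.

Definition evidence n (S : 'M[R]_n) (G : T -> 'cV[R]_n) (delta : 'cV[R]_n) : R :=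
  \int[gamma]_u expR (- potential S G u delta).

(* The probability measure mu such that d mu / d gamma = f. *)
Definition probability_of_density (f : T -> R) : probability T R :=
  get [set mu : pprobability T R | measurable_fun setT f /\
    forall A, measurable A -> mu A = (\int[gamma]_(u in A) (f u)%:E)%E].

Definition posterior n (S : 'M[R]_n) (G : T -> 'cV[R]_n) (delta : 'cV[R]_n) :
    probability T R :=
  probability_of_density
    (fun u => (evidence S G delta)^-1 * expR (- potential S G u delta)).

Local Open Scope charge_scope.

Definition hellinger (mu nu : probability T R) : R :=
  Num.sqrt (2^-1 * \int[gamma]_u
    (Num.sqrt (fine (('d (charge_of_finite_measure mu) '/d gamma) u)) -
     Num.sqrt (fine (('d (charge_of_finite_measure nu) '/d gamma) u))) ^+ 2).

End inverse_problem.

(* Main.v *)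
Require Import Defs.
From HB Require Import structures.
From mathcomp Require Import all_boot all_order all_algebra.
From mathcomp Require Import all_classical all_reals all_analysis.
From mathcomp Require Import measurable_realfun ess_sup_inf ring lra.
Set Implicit Arguments.
Unset Strict Implicit.
Unset Printing Implicit Defensive.
Import Order.TTheory GRing.Theory Num.Theory.
Import numFieldNormedType.Exports.
Local Open Scope classical_set_scope.
Local Open Scope ring_scope.

(** The posterior density at u is exp (- t ^ 2 / 2) / Z, where the misfit
    t = |delta - G u|_Sigma changes by at most |delta - delta'|_Sigma when the
    data change. The function t |-> exp (- t ^ 2 / 4) is Lipschitz on [0, oo[
    ([gauss_lipschitz]), so the square roots of the likelihoods are Lipschitz
    in the data, uniformly in u, whatever the size of G u. It follows that the
    evidence Z is Lipschitz as well; on bounded sets of data it is bounded away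
    from 0, and so the normalised square roots are uniformly Lipschitz
    ([sqrt_density_lipschitz]). As the base measure is finite, integrating the
    square of this bound gives the estimate of the Hellinger distance
    ([hellinger_posterior_lipschitz]).

    It remains to see that the forward map G is measurable, so that the
    densities are. This is the analytic part of the proof, because G is built
    from infima over uncountably many paths. With
    rho (u, v) = sum_i |u_i - v_i| b_i, the form of the slowness gives
    s (x, u) <= exp (rho (u, v)) s (x, v) for all x in the closure of the
    domain ([slowness_ratio]), and this ratio bound passes to the length of each
    path and to the infimum: T (x, u) <= exp (rho (u, v)) T (x, v)
    ([travel_time_ratio]). The parameter space is separable for rho, the finite
    rational sequences being dense, so T (x, u) is the infimum of
    exp (rho (u, v)) T (x, v) over a countable set of v, and each of these
    functions of u is measurable ([measurable_ratio_lipschitz]).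

    The slowness formula and the bounds |psi_i| <= b_i hold only almost
    everywhere. Passing from there to every point of the closure, by continuity,
    requires that nonempty open sets have positive Lebesgue measure
    ([box_not_negligible]), which is proved here by induction on the
    dimension. *)

(** * Nonempty open sets are not Lebesgue-negligible *)

Lemma lebesgue_measure_ioo (R : realType) (a b : R) :
  lebesgue_measure `]a, b[%classic = (Num.max 0 (b - a))%:E.
Proof.
rewrite lebesgue_measure_itv/= lte_fin; case: ltP => ab.
  by rewrite -EFinB; congr EFin; rewrite max_r// subr_ge0 ltW.
by rewrite max_l// subr_le0.
Qed.

(** Weights rather than plain covers make the induction on the dimension work:
    freezing the last coordinate at t turns each box into a box of one
    dimension less, whose weight is multiplied by the indicator of the last
    side at t. Integrating the induction hypothesis over t, term by term,
    restores the missing factor of every volume. *)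
Lemma fractional_box_cover (R : realType) n (w : nat -> R)
    (a b : nat -> nat -> R) (l h : nat -> R) :
  (forall k, 0 <= w k) -> (forall i, l i < h i) ->
  (forall x : nat -> R, (forall i, l i < x i < h i) ->
    (1 <= \sum_(k <oo)
      (w k * \prod_(i < n) \1_(`]a k i, b k i[%classic) (x i))%:E)%E) ->
  ((\prod_(i < n) (h i - l i))%:E <=
    \sum_(k <oo) (w k * \prod_(i < n) Num.max 0 (b k i - a k i))%:E)%E.
Proof.
move=> w0 lh; elim: n w w0 => [|n IH] w w0 cov.
  (* In dimension 0 both products are empty, and any point of the cube will
     do. *)
  rewrite big_ord0; apply: le_trans (cov (fun i => (l i + h i) / 2) _) _.
    by move=> i; have := lh i; rewrite midf_lt// => ?; rewrite midf_lt.
  under eq_eseriesr do rewrite big_ord0.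
  by under [leRHS]eq_eseriesr do rewrite big_ord0.
pose wt (t : R) k := w k * \1_(`]a k n, b k n[%classic) t.
pose P k := \prod_(i < n) Num.max 0 (b k i - a k i).
have P0 k : 0 <= P k by apply: prodr_ge0 => i _; rewrite le_max lexx.
pose f (t : R) : \bar R := (\sum_(k <oo) (wt t k * P k)%:E)%E.
have step t : l n < t < h n -> ((\prod_(i < n) (h i - l i))%:E <= f t)%E.
  move=> tn; apply: IH => [k|x hx].
    by rewrite mulr_ge0.
  apply: le_trans (cov (fun i => if i == n then t else x i) _) _.
    by move=> i; case: eqP => [->|].
  rewrite le_eqVlt; apply/orP; left; apply/eqP; apply: eq_eseriesr => k _.
  rewrite big_ord_recr/= eqxx /wt; congr EFin.
  rewrite -mulrA; congr (_ * _); rewrite mulrC; congr (_ * _).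
  by apply: eq_bigr => i _; rewrite ltn_eqF.
have mterm k : measurable_fun [set: R] (fun t => (wt t k * P k)%:E).
  apply/measurable_EFinP; apply: measurable_funM => //.
  by apply: measurable_funM.
have term0 k t : (0 <= (wt t k * P k)%:E)%E.
  by rewrite lee_fin !mulr_ge0.
have <- : (\int[lebesgue_measure]_t f t =
    \sum_(k <oo) (w k * \prod_(i < n.+1) Num.max 0 (b k i - a k i))%:E)%E.
  rewrite integral_nneseries//.
  apply: eq_eseriesr => k _.
  under eq_integral do rewrite /wt mulrAC EFinM.
  rewrite ge0_integralZl//.
  - rewrite integral_indic// setIT [X in (_ * X)%E]lebesgue_measure_ioo -EFinM.
    by rewrite big_ord_recr/= mulrA.
  - by apply/measurable_EFinP.
  - by rewrite lee_fin mulr_ge0.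
have mf : measurable_fun [set: R] f.
  by apply: ge0_emeasurable_sum.
apply: (@le_trans _ _
    (\int[lebesgue_measure]_(t in `]l n, h n[) f t)%E); last first.
  apply: ge0_subset_integral => //.
  by move=> t _; apply: nneseries_ge0.
rewrite big_ord_recr/=.
apply: (@le_trans _ _ (\int[lebesgue_measure]_(t in `]l n, h n[)
    (cst (\prod_(i < n) (h i - l i))%:E) t)%E).
  rewrite integral_cst// [X in (_ * X)%E]lebesgue_measure_ioo max_r -?EFinM//.
  by rewrite subr_ge0 ltW.
apply: ge0_le_integral => //.
- move=> t _; rewrite lee_fin.
  by apply: prodr_ge0 => i _; rewrite subr_ge0 ltW.
- exact: measurable_funTS.
Qed.

(** The outer measure of a box is at least its volume: apply the preceding
    lemma to an arbitrary cover by boxes, all with weight 1. *)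
Lemma box_not_negligible (R : realType) (d : nat) (a b : 'rV[R]_d.+1) :
  (forall i, a 0 i < b 0 i) -> ~ (@lebesgue_rV R d).-negligible (box (a, b)).
Proof.
move=> ab [A [mA A0 bA]].
have : (@lebesgue_outer R d (box (a, b)) <= 0)%E.
  by rewrite -A0; exact: (le_outer_measure (@lebesgue_outer_measure R d)).
apply/negP; rewrite -ltNge.
apply: (@lt_le_trans _ _ (\prod_(i < d.+1) (b 0 i - a 0 i))%:E).
  by rewrite lte_fin; apply: prodr_gt0 => i _; rewrite subr_gt0.
apply: le_ereal_inf_tmp => _ [F cF <-].
pose e (v : 'rV[R]_d.+1) (i : nat) := v 0 (inord i).
have := @fractional_box_cover R d.+1 (fun=> 1) (fun k => e (F k).1)
  (fun k => e (F k).2) (e a) (e b) (fun=> ler01) (fun i => ab _).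
have prodE (u v : 'rV[R]_d.+1) (g : R -> R -> R) :
    \prod_(i < d.+1) g (e u i) (e v i) = \prod_i g (u 0 i) (v 0 i).
  by apply: eq_bigr => i _; rewrite /e inord_val.
rewrite (prodE b a (fun x y => x - y)) => H.
apply: le_trans (H _) _.
  move=> x xab; have [|k _ Fk] := cF (\row_i x i).
    by move=> i /=; have := xab i; rewrite /e inord_val mxE.
  rewrite (nneseriesD1 (n := k))//; last first.
    by move=> j _; rewrite lee_fin mul1r; apply: prodr_ge0.
  rewrite mul1r big1 ?leeDl//.
    apply: nneseries_ge0 => j _ _.
    by rewrite lee_fin mul1r; apply: prodr_ge0.
  move=> i _; rewrite indicE mem_set//= in_itv/= /e inord_val.
  by have := Fk i; rewrite mxE.
rewrite le_eqVlt; apply/orP; left; apply/eqP; apply: eq_eseriesr => k _.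
by rewrite mul1r (prodE (F k).2 (F k).1 (fun x y => Num.max 0 (x - y))).
Qed.

(** This is what turns inequalities valid almost everywhere in the domain into
    inequalities between continuous functions on its closure. *)
Lemma open_meets_ae (R : realType) (d : nat) (B W : set 'rV[R]_d.+1) :
  {ae @lebesgue_rV R d, forall x, B x} -> open W -> W !=set0 ->
  exists2 x, W x & B x.
Proof.
move=> aeB oW [x Wx]; apply/not_exists2P => H.
have /nbhs_ballP[e /= e0 eW] := open_nbhs_nbhs (conj oW Wx).
apply: (@box_not_negligible R d (x - const_mx e) (x + const_mx e)).
  by move=> i; rewrite !mxE; lra.
apply: negligibleS aeB => y /= xy; rewrite /setC/=; have := H y.
case=> // nWy; exfalso; apply: nWy; apply: eW; split=> // i j.
have := xy j; rewrite /= !mxE (ord1 i) /ball/= => /andP[? ?].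
by rewrite ltr_norml; apply/andP; split; lra.
Qed.

(** * Comparison of slowness functions *)

Lemma Linfty_norm_ge0 (R : realType) (d : nat) (Omega : set 'rV[R]_d.+1)
    (f : 'rV[R]_d.+1 -> R) : 0 <= Linfty_norm Omega f.
Proof. by rewrite fine_ge0// Lnorm_ge0. Qed.

(** The norm is defined by cases on the total mass; when the mass vanishes, the
    whole space is the exceptional set. *)
Lemma Linfty_ae_bound (R : realType) (d : nat) (Omega : set 'rV[R]_d.+1)
    (f : 'rV[R]_d.+1 -> R) : Linfty Omega f ->
  {ae @lebesgue_rV R d, forall x, Omega x -> `|f x| <= Linfty_norm Omega f}.
Proof.
rewrite /Linfty /Linfty_norm => /andP[_ /set_mem/= fin].
move: fin; rewrite /finite_norm unlock /Lnorm; case: ifPn => [mu0 efin|mu0 _].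
  have e0 : (0 <= ess_sup (@lebesgue_rV R d) (abse \o (EFin \o f \_ Omega)))%E.
    by apply: ess_sup_gee => //; apply: aeW => t; exact: abse_ge0.
  apply: filterS (ess_sup_ge (@lebesgue_rV R d) (abse \o (EFin \o f \_ Omega))).
  move=> x /=; rewrite patchE => + Ox; rewrite mem_set// -lee_fin fineK//.
  by rewrite ge0_fin_numE.
exists setT; split => //.
by apply/eqP; move: mu0; rewrite lt_neqAle measure_ge0 andbT negbK eq_sym.
Qed.

Section weighted_l1.
Context {R : realType}.
Implicit Types b u v : nat -> R.

Definition wsummable b u := cvgn (series (fun i => `|u i| * b i)).

(** For a nonnegative weight b this is a pseudodistance on the b-summable
    sequences, as b may vanish at some indices. *)
Definition wdist b u v : R := limn (series (fun i => `|u i - v i| * b i)).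

Lemma wdistC b u v : wdist b u v = wdist b v u.
Proof.
by rewrite /wdist; congr (limn (series _)); apply/funext => i; rewrite distrC.
Qed.

Lemma wsummableB b u v : (forall i, 0 <= b i) ->
  wsummable b u -> wsummable b v ->
  wsummable b (fun i => u i - v i).
Proof.
move=> b0 su sv; have : cvgn (series (fun i => `|u i| * b i + `|v i| * b i)) :=
  is_cvg_seriesD su sv.
apply: series_le_cvg => i.
- by rewrite mulr_ge0.
- by rewrite addr_ge0// mulr_ge0.
- by rewrite -mulrDl ler_wpM2r// ler_normB.
Qed.

Lemma wdist_ge0 b u v : (forall i, 0 <= b i) ->
  wsummable b u -> wsummable b v ->
  0 <= wdist b u v.
Proof.
move=> b0 su sv; apply: limr_ge; first exact: wsummableB.
by apply: nearW => n; apply: sumr_ge0 => i _; rewrite mulr_ge0.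
Qed.

Lemma wsummable_cvg b u a : (forall i, `|a i| <= b i) -> wsummable b u ->
  cvgn [normed series (fun i => u i * a i)].
Proof.
move=> ab; apply: series_le_cvg => i.
- exact: normr_ge0.
- by rewrite mulr_ge0// (le_trans _ (ab i)).
- by rewrite /= normrM ler_wpM2l.
Qed.

Lemma series_le_wdist b u v a : (forall i, `|a i| <= b i) ->
  wsummable b u -> wsummable b v ->
  limn (series (fun i => u i * a i)) <=
  limn (series (fun i => v i * a i)) + wdist b u v.
Proof.
move=> ab su sv; rewrite -lerBlDl.
have b0 i : 0 <= b i by exact: le_trans (ab i).
rewrite -lim_seriesB; [|exact/normed_cvg/wsummable_cvg..].
have cd := wsummable_cvg ab (wsummableB b0 su sv).
rewrite (_ : _ - _ = (fun i => (u i - v i) * a i)); last first.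
  by apply/funext => i; rewrite mulrBl.
apply: le_trans (ler_norm _) _; apply: le_trans (lim_series_norm cd) _.
apply: lim_series_le => //; first exact: wsummableB.
by move=> i; rewrite /= normrM ler_wpM2l.
Qed.

End weighted_l1.

Section slowness.
Context {R : realType} {d : nat}.
Variables (Omega : set 'rV[R]_d.+1) (psi : nat -> 'rV[R]_d.+1 -> R).
Local Notation b := (fun i => Linfty_norm Omega (psi i)).

Definition udist (u v : Uspace Omega psi) : R := wdist b (coeff u) (coeff v).

Lemma wsummable_coeff (u : Uspace Omega psi) : wsummable b (coeff u).
Proof.
apply: nnseries_is_cvg => [i|]; first by rewrite mulr_ge0// Linfty_norm_ge0.
exact: (set_valP (u : Utype Omega psi)).
Qed.

(** Passing from v to u changes the exponent of the slowness by at most the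
    distance between u and v. Since s_star is nonnegative and the factor
    exp (udist u v) is at least 1, the whole slowness grows at most by that
    factor. The bound holds almost everywhere in Omega and extends to the
    closure by continuity. *)
Lemma slowness_ratio (s_star s_bar : 'rV[R]_d.+1 -> R)
    (s : 'rV[R]_d.+1 -> Uspace Omega psi -> R) : open Omega ->
  (forall i, Linfty Omega (psi i)) ->
  {ae @lebesgue_rV R d, forall x, Omega x -> 0 <= s_star x} ->
  (forall u, {ae @lebesgue_rV R d, forall x, Omega x ->
     s x u = s_star x +
       expR (s_bar x + limn (series (fun i => coeff u i * psi i x)))}) ->
  (forall u, {within closure Omega, continuous (s ^~ u)}) ->
  forall u v x, closure Omega x -> s x u <= expR (udist u v) * s x v.
Proof.
move=> oO psiL star0 sE sc u v x Ox; rewrite leNgt; apply/negP => lt_sx.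
pose h y := s y u - expR (udist u v) * s y v.
have hx : 0 < h x by rewrite subr_gt0.
have hc : h @ within (closure Omega) (nbhs x) --> h x.
  apply: cvgB; first by move/subspace_continuousP : (sc u); exact.
  by apply: cvgMr; move/subspace_continuousP : (sc v); exact.
have : \forall y \near within (closure Omega) (nbhs x), 0 < h y.
  exact: (cvgr_gt _ hc).
rewrite near_withinE => hn.
have [W [oW Wx WO]] : exists W,
    [/\ open W, W x & forall y, W y -> closure Omega y -> 0 < h y].
  by move: hn; rewrite nearE nbhsE => -[W [oW Wx] WP]; exists W.
have [y [Oy Wy]] : (Omega `&` W) !=set0.
  exact: Ox (open_nbhs_nbhs (conj oW Wx)).
have aeP : {ae @lebesgue_rV R d,
    forall z, (forall i, Omega z -> `|psi i z| <= b i)}.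
  by apply: ae_foralln => i; exact: Linfty_ae_bound.
have [z [Oz Wz]] : exists2 z, (Omega `&` W) z & (Omega z -> ~ (0 < h z)).
  apply: (@open_meets_ae _ _ (fun z => Omega z -> ~ (0 < h z)));
    [|exact: openI|by exists y].
  have [_ F2 F3] := @ae_filter_ringOfSetsType _ _ _ (@lebesgue_rV R d).
  apply: F3 (F2 _ _ star0 (F2 _ _ (F2 _ _ (sE u) (sE v)) aeP)).
  move=> z [st [[su sv] psib]] Oz; apply/negP.
  rewrite -leNgt subr_le0 su// sv//.
  have luv := series_le_wdist (fun i => psib i Oz)
    (@wsummable_coeff u) (@wsummable_coeff v).
  have d0 : 0 <= udist u v.
    exact: wdist_ge0 (fun i => Linfty_norm_ge0 _ _)
      (@wsummable_coeff u) (@wsummable_coeff v).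
  rewrite mulrDr -expRD; apply: lerD.
    by rewrite ler_peMl ?st// -expR0 ler_expR.
  by rewrite ler_expR; rewrite /udist; lra.
by case/(_ Oz); apply: WO => //; exact: subset_closure.
Qed.

End slowness.

(** * Comparison of travel times *)

(** The comparison is assumed in both directions because the integrals are
    reals, an infinite integral having value 0: two-sided comparability makes
    them infinite together. *)
Lemma Rintegral_ratio d (T : measurableType d) (R : realType)
    (mu : {measure set T -> \bar R}) (D : set T) (f g : T -> R) (k : R) :
  measurable D -> measurable_fun D f -> measurable_fun D g -> 0 < k ->
  (forall x, D x -> 0 <= f x <= k * g x) ->
  (forall x, D x -> 0 <= g x <= k * f x) ->
  \int[mu]_(x in D) f x <= k * \int[mu]_(x in D) g x.
Proof.
move=> mD mf mg k0 fg gf; rewrite /Rintegral.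
have le_int (f1 f2 : T -> R) : measurable_fun D f1 -> measurable_fun D f2 ->
    (forall x, D x -> 0 <= f1 x <= k * f2 x) ->
    (forall x, D x -> 0 <= f2 x) ->
    (\int[mu]_(x in D) (f1 x)%:E <= k%:E * \int[mu]_(x in D) (f2 x)%:E)%E.
  move=> m1 m2 f12 f20; rewrite -ge0_integralZl//;
    [|by apply/measurable_EFinP|by rewrite lee_fin ltW].
  apply: ge0_le_integral => //.
  - by move=> x /f12/andP[? _]; rewrite lee_fin.
  - by apply/measurable_EFinP.
  - by apply/measurable_EFinP; apply: measurable_funM.
  - by move=> x /f12/andP[_ ?]; rewrite -EFinM lee_fin.
have f0 x : D x -> 0 <= f x by move=> /fg/andP[].
have g0 x : D x -> 0 <= g x by move=> /gf/andP[].
have If : (0 <= \int[mu]_(x in D) (f x)%:E)%E by apply: integral_ge0 => x /f0.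
have Ig : (0 <= \int[mu]_(x in D) (g x)%:E)%E by apply: integral_ge0 => x /g0.
have := le_int _ _ mf mg fg g0; have := le_int _ _ mg mf gf f0.
(* If one integral is infinite so is the other, and both real values are 0. *)
case: (\int[mu]_(x in D) (f x)%:E)%E If => [a| |]//=;
  case: (\int[mu]_(x in D) (g x)%:E)%E Ig => [b| |]//=.
by rewrite mulr0.
Qed.

Lemma measurable_enorm d (T : measurableType d) (R : realType) m n (D : set T)
    (f : T -> 'M[R]_(m, n)) :
  (forall i j, measurable_fun D (fun t => f t i j)) ->
  measurable_fun D (fun t => enorm (f t)).
Proof.
move=> mf; apply: (@measurableT_comp _ _ _ _ _ _ (@Num.sqrt R)).
  by apply: continuous_measurable_fun; exact: sqrt_continuous.
apply: measurable_sum => i; apply: measurable_sum => j.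
exact: measurable_funX.
Qed.

Lemma cvg_within_image (T : Type) (U : topologicalType) (F : set_system T)
    (f : T -> U) (C : set U) (y : U) : Filter F ->
  f @ F --> y -> F [set t | C (f t)] -> f @ F --> within C (nbhs y).
Proof.
move=> FF fy FC A nA; change (F [set t | A (f t)]).
have FCA : F [set t | C (f t) -> A (f t)] := fy _ nA.
by apply: filterS2 FC FCA => t ?; exact.
Qed.

Section travel_time_ratio.
Context {R : realType} {d : nat}.
Local Notation V := 'rV[R]_d.+1.
Variables (Omega : set V) (x0 : V).

Let speed_measurable (xi : R -> V) (xi' : R -> V) : W1infty xi xi' ->
  measurable_fun (`[0, 1] : set R) (fun r => enorm (xi' r)).
Proof.
move=> [_ Wxi]; apply: measurable_enorm => i j; rewrite (ord1 i).
have [/andP[+ _] _] := Wxi j; rewrite inE/= => m.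
by apply/(measurable_restrictT _ _).2.
Qed.

Let slowness_measurable (s : V -> R) (xi xi' : R -> V) :
  {within closure Omega, continuous s} -> W1infty xi xi' ->
  (forall r, 0 <= r <= 1 -> closure Omega (xi r)) ->
  measurable_fun (`[0, 1] : set R) (s \o xi).
Proof.
move=> sc [xic _] xiO; apply: subspace_continuous_measurable_fun => //.
apply/subspace_continuousP => r r01.
have xir : closure Omega (xi r) by apply: xiO; move: r01; rewrite /= in_itv.
apply: (@cvg_comp _ _ _ xi s _ (within (closure Omega) (nbhs (xi r)))).
  apply: cvg_within_image; first by move/subspace_continuousP : xic; exact.
  by near=> t; apply: xiO; near: t; exact: withinT.
by move/subspace_continuousP : sc; exact.
Unshelve. all: by end_near. Qed.

Lemma travel_time_ge0 (s : V -> R) (x : V) :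
  (forall y, closure Omega y -> 0 < s y) -> 0 <= travel_time Omega x0 s x.
Proof.
move=> s0; rewrite /travel_time.
have [->|/set0P[xi0 Pxi0]] := eqVneq (paths Omega x0 x) set0.
  by rewrite image_set0 inf0.
apply: lb_le_inf; first by eexists; exists xi0.
move=> _ [xi [_ xiO _ _] <-]; apply: Rintegral_ge0 => r /=.
by rewrite in_itv/= => /xiO /s0/ltW ?; rewrite mulr_ge0// sqrtr_ge0.
Qed.

(** The comparison holds for the length of each admissible path, and the
    admissible paths are the same for both slowness functions, so it passes to
    the infimum. If there is no path, both infima are 0. *)
Lemma travel_time_ratio (s1 s2 : V -> R) (k : R) (x : V) : 0 < k ->
  {within closure Omega, continuous s1} ->
  {within closure Omega, continuous s2} ->
  (forall y, closure Omega y -> 0 < s1 y) ->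
  (forall y, closure Omega y -> 0 < s2 y) ->
  (forall y, closure Omega y -> s1 y <= k * s2 y) ->
  (forall y, closure Omega y -> s2 y <= k * s1 y) ->
  travel_time Omega x0 s1 x <= k * travel_time Omega x0 s2 x.
Proof.
move=> k0 c1 c2 p1 p2 s12 s21; rewrite /travel_time.
have [->|/set0P[xi0 Pxi0]] := eqVneq (paths Omega x0 x) set0.
  by rewrite !image_set0 !inf0 mulr0.
rewrite -ler_pdivrMl//; apply: lb_le_inf; first by eexists; exists xi0.
move=> _ [xi [W xiO xia xib] <-]; rewrite ler_pdivrMl//.
have xi_in r : r \in `[0, 1] -> closure Omega (xi.1 r).
  by rewrite in_itv/= => /xiO.
apply: (@le_trans _ _ (\int[lebesgue_measure]_(r in `[0, 1])
    (s1 (xi.1 r) * enorm (xi.2 r)))).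
  apply: ge_inf; last by exists xi.
  exists 0 => _ [zeta [_ zO _ _] <-]; apply: Rintegral_ge0 => r /=.
  by rewrite in_itv/= => /zO /p1/ltW ?; rewrite mulr_ge0// sqrtr_ge0.
apply: Rintegral_ratio => //.
- apply: measurable_funM; last exact: speed_measurable W.
  exact: slowness_measurable c1 W xiO.
- apply: measurable_funM; last exact: speed_measurable W.
  exact: slowness_measurable c2 W xiO.
- move=> r /xi_in Or; apply/andP; split.
    by rewrite mulr_ge0 ?sqrtr_ge0// ltW// p1.
  by rewrite mulrA ler_wpM2r ?sqrtr_ge0// s12.
- move=> r /xi_in Or; apply/andP; split.
    by rewrite mulr_ge0 ?sqrtr_ge0// ltW// p2.
  by rewrite mulrA ler_wpM2r ?sqrtr_ge0// s21.
Qed.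

End travel_time_ratio.

(** * Measurability in the parameter *)

Section rational_sequences.
Context {R : realType}.

Definition rat_seq (q : seq rat) (i : nat) : R := ratr (nth 0 q i).

Lemma wsummable_rat (b : nat -> R) q : wsummable b (rat_seq q).
Proof.
apply: (cvgP (series (fun i => `|rat_seq q i| * b i) (size q))).
apply: cvg_near_cst.
near=> n; have qn : (size q <= n)%N by near: n; exists (size q).
rewrite seriesEnat/= (big_cat_nat _ qn)//= [X in _ + X]big_nat_cond.
rewrite [X in _ + X]big1 ?addr0// => i /andP[/andP[qi _] _].
by rewrite /rat_seq nth_default// (rmorph0 (@ratr R)) normr0 mul0r.
Unshelve. all: by end_near. Qed.

(** Cut u where its tail has weight less than e / 2, and approximate the
    remaining finitely many entries by rationals. *)
Lemma wdist_rat_dense (b u : nat -> R) (e : R) : (forall i, 0 <= b i) ->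
  wsummable b u -> 0 < e -> exists q, wdist b u (rat_seq q) < e.
Proof.
move=> b0 su e0.
pose S := series (fun i => `|u i| * b i).
have Sle m : S m <= limn S.
  apply: nondecreasing_cvgn_le => //; apply/nondecreasing_seqP => k.
  by rewrite /S seriesSr lerDl mulr_ge0.
have [n Sn] : exists n, limn S - S n < e / 2.
  have e20 : 0 < e / 2 by rewrite divr_gt0.
  have /cvgrPdist_lt/(_ _ e20)[n _ /(_ n (leqnn n))] := su.
  by move=> /(le_lt_trans (ler_norm _)); exists n.
pose B := \sum_(0 <= i < n) b i.
have B0 : 0 <= B by apply: sumr_ge0.
(* The total error on the first n entries is at most del * B <= e / 2; the
   summand 1 takes care of B = 0. *)
pose del := e / 2 / (B + 1).
have del0 : 0 < del by rewrite !divr_gt0// ltr_wpDl.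
have /choice[r ru] : forall i, exists r : rat, `|u i - ratr r| <= del.
  move=> i; have /rat_in_itvoo[r] : u i - del < u i + del by lra.
  rewrite in_itv/= => /andP[? ?]; exists r.
  by rewrite ler_norml; apply/andP; split; lra.
exists (mkseq r n).
apply: (@le_lt_trans _ _ (del * B + (limn S - S n))); last first.
  have : del * B <= e / 2.
    rewrite /del -mulrA ler_piMr//; first by rewrite ltW// divr_gt0.
    by rewrite mulrC ler_pdivrMr ?mul1r ?lerDl// ltr_wpDl.
  by lra.
apply: limr_le.
  by apply: wsummableB => //; exact: wsummable_rat.
near=> m.
have nm : (n <= m)%N by near: m; exists n.
have -> : S n = \sum_(0 <= i < n) `|u i| * b i by [].
rewrite /series /= (big_cat_nat _ nm)//= lerD//.
  rewrite /B mulr_sumr !big_mkord; apply: ler_sum => i _.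
  by rewrite ler_wpM2r// /rat_seq nth_mkseq.
rewrite lerBrDl; apply: le_trans (Sle m).
rewrite /S /series /= [leRHS](big_cat_nat _ nm)//= lerD2l.
apply: ler_sum_nat => i /andP[ni _].
by rewrite /rat_seq nth_default ?size_mkseq// (rmorph0 (@ratr R)) subr0.
Unshelve. all: by end_near. Qed.

End rational_sequences.

Section measurability.
Context {R : realType} {d : nat}.
Variables (Omega : set 'rV[R]_d.+1) (psi : nat -> 'rV[R]_d.+1 -> R).
Local Notation b := (fun i => Linfty_norm Omega (psi i)).
Local Notation U := (Uspace Omega psi).

Lemma measurable_coeff i : measurable_fun [set: U] (fun u => coeff u i).
Proof.
move=> _ Y mY; exists [set v : Rinfty R | Y (v i)]; last by [].
by apply: sub_sigma_algebra; exists i => //; exists Y; rewrite // setTI.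
Qed.

Lemma measurable_udist (v : U) : measurable_fun [set: U] (fun u => udist u v).
Proof.
apply: (@measurable_fun_cvg _ _ _ _
  (fun n u => series (fun i => `|coeff u i - coeff v i| * b i) n)).
  move=> n; apply: measurable_sum => i; apply: measurable_funM => //.
  apply: measurableT_comp => //; apply: measurable_funB => //.
  exact: measurable_coeff.
move=> u _; apply: wsummableB; [|exact: wsummable_coeff..].
by move=> i; exact: Linfty_norm_ge0.
Qed.

Lemma Uset_rat_seq q : Uset Omega psi (rat_seq q : nat -> R).
Proof.
rewrite /Uset/=; under eq_fun do rewrite sumEFin.
by rewrite -[X in limn X]/(EFin \o _) EFin_lim ?ltry//; exact: wsummable_rat.
Qed.

(** An enumeration of a countable dense subset of the parameter space; codes
    that represent no sequence give the zero parameter. *)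
Definition rat_param (n : nat) : U :=
  exist _ (rat_seq (odflt [::] (unpickle n)) : Rinfty R)
    (mem_set (Uset_rat_seq _)).

Lemma rat_param_dense (u : U) (e : R) : 0 < e ->
  exists n, udist u (rat_param n) < e.
Proof.
move=> e0; have [|q] := wdist_rat_dense _ (@wsummable_coeff _ _ _ _ u) e0.
  by move=> i; exact: Linfty_norm_ge0.
by exists (pickle q); rewrite /rat_param pickleK.
Qed.

(** The trace of the product sigma-algebra is large enough for functions that
    are continuous for the weighted distance, as the space is separable: T is
    the infimum over the dense parameters v of the measurable functions
    u |-> exp (udist u v) * T v. The infimum is not below T by hypothesis, and
    letting v tend to u shows that it is not above. *)
Lemma measurable_ratio_lipschitz (T : U -> R) : (forall u, 0 <= T u) ->
  (forall u v, T u <= expR (udist u v) * T v) -> measurable_fun [set: U] T.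
Proof.
move=> T0 Tratio.
pose Tn n u := expR (udist u (rat_param n)) * T (rat_param n).
apply: (measurability _ (RGenInftyO.measurableE R)) => _ [_ [a ->] <-].
rewrite setTI [X in measurable X](_ : _ =
  \bigcup_n [set u | Tn n u < a]); last first.
  apply/seteqP; split => u /=; rewrite ?in_itv/=; last first.
    by move=> [n _ /=]; apply: le_lt_trans; exact: Tratio.
  move=> Tua.
  (* Room for two factors: one from the parameter to the dense point, one
     back. *)
  have [e e0 ea] : exists2 e, 0 < e & expR (e + e) * T u < a.
    have [Tu0|Tu0] := leP (T u) 0.
      have Tu : T u = 0 by apply/eqP; rewrite eq_le Tu0 T0.
      by exists 1; rewrite // Tu mulr0 -Tu.
    have aT : 1 < a / T u by rewrite ltr_pdivlMr// mul1r.
    exists (ln (a / T u) / 3); first by rewrite divr_gt0// ln_gt0.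
    have l0 := ln_gt0 aT.
    rewrite -ltr_pdivlMr// -[ltRHS]lnK ?posrE ?(lt_trans _ aT)// ltr_expR.
    by lra.
  have [n un] := rat_param_dense u e0; exists n => //=; apply: le_lt_trans ea.
  rewrite /Tn expRD -mulrA; apply: ler_pM => //.
    by rewrite ler_expR ltW.
  apply: le_trans (Tratio _ u) _.
  by rewrite ler_wpM2r// ler_expR /udist wdistC ltW.
apply: bigcupT_measurable => n.
rewrite -[X in measurable X]setTI.
have mE : measurable_fun [set: U] (Tn n).
  apply: measurable_funM => //; apply: measurableT_comp => //.
  exact: measurable_udist.
have := mE measurableT `]-oo, a[%classic (measurable_itv _).
by congr measurable; apply/seteqP; split => u; rewrite /= in_itv.
Qed.

End measurability.

(** * The Euclidean norm and the Gaussian profile *)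

Lemma cauchy_schwarz_sum (R : realType) (I : finType) (a b : I -> R) :
  (\sum_i a i * b i) ^+ 2 <= (\sum_i a i ^+ 2) * (\sum_i b i ^+ 2).
Proof.
set A := \sum_i a i ^+ 2; set B := \sum_i b i ^+ 2; set C := \sum_i a i * b i.
have A0 : 0 <= A by apply: sumr_ge0 => i _; exact: sqr_ge0.
have quad t : 0 <= A - 2 * t * C + t ^+ 2 * B.
  have -> : A - 2 * t * C + t ^+ 2 * B = \sum_i (a i - t * b i) ^+ 2.
    rewrite /A /C /B !mulr_sumr -sumrB -big_split/=.
    by apply: eq_bigr => i _; ring.
  by apply: sumr_ge0 => i _; exact: sqr_ge0.
have B0 : 0 <= B by apply: sumr_ge0 => i _; exact: sqr_ge0.
have [B00|B00] := eqVneq B 0.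
  have [->|C0] := eqVneq C 0; first by rewrite expr0n/= mulr_ge0.
  have := quad ((A + 1) / (2 * C)).
  rewrite B00 mulr0 addr0 (_ : 2 * _ * C = A + 1); first by lra.
  by field.
have Bp : 0 < B by rewrite lt_neqAle eq_sym B00.
have := quad (C / B); rewrite (_ : _ + _ = (A * B - C ^+ 2) / B); last by field.
by rewrite pmulr_lge0 ?invr_gt0// subr_ge0.
Qed.

Lemma enormE (R : realType) m n (v : 'M[R]_(m, n)) :
  enorm v = Num.sqrt (\sum_(p : 'I_m * 'I_n) v p.1 p.2 ^+ 2).
Proof. by rewrite /enorm pair_big. Qed.

Lemma enorm_ge0 (R : realType) m n (v : 'M[R]_(m, n)) : 0 <= enorm v.
Proof. exact: sqrtr_ge0. Qed.

Lemma sqr_enorm (R : realType) m n (v : 'M[R]_(m, n)) :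
  enorm v ^+ 2 = \sum_(p : 'I_m * 'I_n) v p.1 p.2 ^+ 2.
Proof.
by rewrite enormE sqr_sqrtr//; apply: sumr_ge0 => p _; exact: sqr_ge0.
Qed.

Lemma enormD (R : realType) m n (v w : 'M[R]_(m, n)) :
  enorm (v + w) <= enorm v + enorm w.
Proof.
rewrite -(@ler_pXn2r _ 2)// ?nnegrE ?addr_ge0 ?enorm_ge0//.
rewrite sqrrD !sqr_enorm.
have /ler_sqrt : 0 <= (\sum_p v p.1 p.2 ^+ 2) * (\sum_p w p.1 p.2 ^+ 2).
  by rewrite -!sqr_enorm mulr_ge0// sqr_ge0.
move/(_ ((\sum_p v p.1 p.2 * w p.1 p.2) ^+ 2)); rewrite cauchy_schwarz_sum.
rewrite sqrtr_sqr sqrtrM -?sqr_enorm ?sqr_ge0// !sqrtr_sqr.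
rewrite !(ger0_norm (enorm_ge0 _)) !sqr_enorm => cs.
have := le_trans (ler_norm _) cs.
have -> : \sum_p (v + w) p.1 p.2 ^+ 2 = \sum_p v p.1 p.2 ^+ 2
    + (\sum_p v p.1 p.2 * w p.1 p.2) *+ 2 + \sum_p w p.1 p.2 ^+ 2.
  rewrite -sumrMnl -!big_split/=; apply: eq_bigr => p _.
  by rewrite mxE sqrrD.
by rewrite lerD2r lerD2l ler_pMn2r.
Qed.

Lemma enormN (R : realType) m n (v : 'M[R]_(m, n)) : enorm (- v) = enorm v.
Proof.
by rewrite !enormE; congr Num.sqrt; apply: eq_bigr => p _; rewrite mxE sqrrN.
Qed.

Lemma enorm_dist (R : realType) m n (v w : 'M[R]_(m, n)) :
  `|enorm v - enorm w| <= enorm (v - w).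
Proof.
have := enormD (v - w) w; have := enormD (w - v) v.
by rewrite !subrK -opprB enormN ler_norml => *; apply/andP; split; lra.
Qed.

(** The Euclidean norm of a matrix (its Frobenius norm) dominates the operator
    norm. *)
Lemma enormM (R : realType) m n (A : 'M[R]_(m, n)) (v : 'cV[R]_n) :
  enorm (A *m v) <= enorm A * enorm v.
Proof.
rewrite -(@ler_pXn2r _ 2)// ?nnegrE ?mulr_ge0 ?enorm_ge0//.
rewrite exprMn {1}/enorm sqr_sqrtr; last first.
  by apply: sumr_ge0 => i _; apply: sumr_ge0 => j _; exact: sqr_ge0.
have -> : enorm A ^+ 2 = \sum_i \sum_j A i j ^+ 2.
  by rewrite sqr_enorm pair_big.
have -> : enorm v ^+ 2 = \sum_j v j 0 ^+ 2.
  rewrite sqr_enorm -(pair_big xpredT xpredT (fun i j => v i j ^+ 2))/=.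
  by apply: eq_bigr => i _; rewrite big_ord1.
rewrite mulr_suml; apply: ler_sum => i _; rewrite big_ord1 mxE.
exact: cauchy_schwarz_sum.
Qed.

Section gauss.
Context {R : realType}.
Implicit Types s t : R.

(** The square root of the unnormalised likelihood exp (- t ^ 2 / 2), as a
    function of the misfit t. *)
Definition gauss t := expR (- (t ^+ 2 / 4)).

Lemma gauss_gt0 t : 0 < gauss t. Proof. exact: expR_gt0. Qed.

Lemma gauss_le1 t : gauss t <= 1.
Proof. by rewrite -expR0 ler_expR; have := sqr_ge0 t; lra. Qed.

Lemma gauss_sqr t : gauss t ^+ 2 = expR (- (2^-1 * t ^+ 2)).
Proof. by rewrite expr2 -expRD; congr expR; lra. Qed.

(** For s <= t the difference is at most 1, which settles the case
    1 <= t - s. Otherwise it is at most gauss s * (t ^ 2 - s ^ 2) / 4, where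
    t + s < 2 s + 1 and the linear growth of this factor is absorbed by
    gauss s <= 1 / (1 + s ^ 2 / 4). *)
Lemma gauss_lipschitz s t : 0 <= s -> 0 <= t ->
  `|gauss s - gauss t| <= `|s - t|.
Proof.
wlog st : s t / s <= t => [W|s0 t0].
  have [/W//|/ltW/W h] := leP s t.
  by move=> s0 t0; rewrite distrC (distrC s); exact: h.
rewrite distrC ler0_norm; last first.
  by rewrite subr_le0 ler_expR lerN2 ler_pM2r// lerXn2r.
rewrite distrC ger0_norm ?subr_ge0// opprB.
have [ts|ts] := leP 1 (t - s).
  by have := gauss_le1 s; have := gauss_gt0 t; lra.
have e1 := expR_ge1Dx (- ((t ^+ 2 - s ^+ 2) / 4)).
have -> : gauss t = gauss s * expR (- ((t ^+ 2 - s ^+ 2) / 4)).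
  by rewrite /gauss -expRD; congr expR; lra.
have e2 : gauss s * (1 + s ^+ 2 / 4) <= 1.
  by rewrite mulrC -ler_pdivlMr ?gauss_gt0// div1r -expRN opprK expR_ge1Dx.
have := gauss_gt0 s; move: e1 e2.
move: (gauss s) (expR _) => g x e1 e2 g0.
have : g * (1 - x) <= g * ((t ^+ 2 - s ^+ 2) / 4).
  by apply: ler_wpM2l; [exact: ltW|lra].
have : g * ((t ^+ 2 - s ^+ 2) / 4) <= t - s.
  have -> : g * ((t ^+ 2 - s ^+ 2) / 4) = (t - s) * (g * ((t + s) / 4)) by ring.
  rewrite ler_piMr ?subr_ge0//; apply: le_trans e2.
  by apply: ler_wpM2l; [exact: ltW|nra].
by lra.
Qed.

End gauss.

(** * Hellinger distance between measures given by densities *)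

Section density.
Context d (T : measurableType d) (R : realType).
Variables (mu : {finite_measure set T -> \bar R}) (f : T -> R).

(** The proofs are parameters so that the probability structure can be attached
    to the definition. *)
Definition density_measure (f0 : forall x, 0 <= f x)
  (mf : measurable_fun [set: T] f)
  (f1 : (\int[mu]_x (f x)%:E = 1)%E) (A : set T) : \bar R :=
  (\int[mu]_(x in A) (f x)%:E)%E.

Hypotheses (f0 : forall x, 0 <= f x) (mf : measurable_fun [set: T] f).
Hypothesis f1 : (\int[mu]_x (f x)%:E = 1)%E.
Local Notation nu := (density_measure f0 mf f1).

Let nu0 : nu set0 = 0%E.
Proof. exact: integral_set0. Qed.

Let nu_ge0 A : (0 <= nu A)%E.
Proof. by apply: integral_ge0 => x _; rewrite lee_fin. Qed.

Let nu_sigma_additive : semi_sigma_additive nu.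
Proof.
apply: semi_sigma_additive_nng_induced; first exact/measurable_EFinP.
by move=> x; rewrite lee_fin.
Qed.

HB.instance Definition _ :=
  isMeasure.Build _ _ _ nu nu0 nu_ge0 nu_sigma_additive.

Let nu_setT : nu [set: T] = 1%E.
Proof. exact: f1. Qed.

HB.instance Definition _ := @Measure_isProbability.Build _ _ R nu nu_setT.

(** The measure with density f exists, so the choice in the definition of
    probability_of_density is not made from an empty set. *)
Lemma probability_of_densityE A : measurable A ->
  probability_of_density mu f A = (\int[mu]_(x in A) (f x)%:E)%E.
Proof.
move=> mA; rewrite /probability_of_density.
case: xgetP => [P _ [_ PE]|/(_ nu)]; first exact: PE.
by case; split.
Qed.

End density.

Section density_derivative.
Context d (T : measurableType d) (R : realType).
Variables (mu : {finite_measure set T -> \bar R}) (f : T -> R).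
Hypotheses (f0 : forall x, 0 <= f x) (mf : measurable_fun [set: T] f).
Hypothesis f1 : (\int[mu]_x (f x)%:E = 1)%E.
Local Open Scope charge_scope.
Local Notation P := (probability_of_density mu f).
Local Notation D := ('d (charge_of_finite_measure P) '/d mu).

Lemma probability_of_density_dominates : charge_of_finite_measure P `<< mu.
Proof.
apply/null_content_dominatesP => A mA A0.
rewrite /charge_of_finite_measure/= probability_of_densityE//.
apply: null_set_integral => //; exact/measurable_funTS/measurable_EFinP.
Qed.

(** A density is determined almost everywhere by its integrals over measurable
    sets. *)
Lemma ae_eq_derivative_of_density : ae_eq mu setT D (EFin \o f).
Proof.
apply: integral_ae_eq => //.
- exact: Radon_Nikodym_integrable probability_of_density_dominates.
- exact/measurable_EFinP.
- move=> A _ mA; rewrite -Radon_Nikodym_integral//.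
    exact: probability_of_densityE.
  exact: probability_of_density_dominates.
Qed.

Lemma measurable_derivative_of_density :
  measurable_fun setT (fun u => fine (D u)).
Proof.
apply: measurableT_comp => //.
apply: measurable_int.
exact: Radon_Nikodym_integrable probability_of_density_dominates.
Qed.

End density_derivative.

Lemma hellinger_densityE d (T : measurableType d) (R : realType)
    (mu : {finite_measure set T -> \bar R}) (f h : T -> R) :
  (forall x, 0 <= f x) -> measurable_fun [set: T] f ->
  (\int[mu]_x (f x)%:E = 1)%E ->
  (forall x, 0 <= h x) -> measurable_fun [set: T] h ->
  (\int[mu]_x (h x)%:E = 1)%E ->
  hellinger mu (probability_of_density mu f) (probability_of_density mu h) =
  Num.sqrt (2^-1 * \int[mu]_u (Num.sqrt (f u) - Num.sqrt (h u)) ^+ 2).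
Proof.
move=> f0 mf f1 h0 mh h1.
have msqrt : measurable_fun [set: R] (@Num.sqrt R).
  by apply: continuous_measurable_fun; exact: sqrt_continuous.
have mH (k l : T -> R) : measurable_fun setT k -> measurable_fun setT l ->
    measurable_fun setT (fun u : T => (Num.sqrt (k u) - Num.sqrt (l u)) ^+ 2).
  move=> mk ml; apply: measurable_funX; apply: measurable_funB.
    exact: measurableT_comp msqrt mk.
  exact: measurableT_comp msqrt ml.
have ae1 := ae_eq_derivative_of_density f0 mf f1.
have ae2 := ae_eq_derivative_of_density h0 mh h1.
have md1 := measurable_derivative_of_density f0 mf f1.
have md2 := measurable_derivative_of_density h0 mh h1.
rewrite /hellinger; congr (Num.sqrt (_ * _)); congr fine.
apply: ae_eq_integral => //.
- exact/measurable_EFinP/(mH _ _ md1 md2).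
- exact/measurable_EFinP/(mH _ _ mf mh).
by apply: filterS2 ae1 ae2 => u /(_ I) -> /(_ I) ->.
Qed.

(** * Lipschitz dependence of the posterior on the data *)

(** Here a and b are square roots of likelihoods, z and z' the square roots of
    the normalising constants. The difference of the quotients is
    (a - b) / z + b (z' - z) / (z z'), and z' - z is the difference of the
    squares divided by z + z' >= 2 k. *)
Lemma quotient_lipschitz (R : realType) (a b k z z' D M : R) :
  0 <= D -> 0 <= M -> 0 < k -> k <= z -> k <= z' -> 0 <= b -> b <= 1 ->
  `|a - b| <= D -> `|z ^+ 2 - z' ^+ 2| <= 2 * D * M ->
  `|a / z - b / z'| <= (k^-1 + M * k^-1 ^+ 3) * D.
Proof.
move=> D0 M0 k0 kz kz' b0 b1 ab zz'.
have z0 : 0 < z := lt_le_trans k0 kz.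
have z'0 : 0 < z' := lt_le_trans k0 kz'.
have zzD : `|z' - z| <= D * M * k^-1.
  rewrite -(ler_pM2r (addr_gt0 z0 z'0)).
  have -> : `|z' - z| * (z + z') = `|z ^+ 2 - z' ^+ 2|.
    by rewrite subr_sqr normrM distrC (@ger0_norm _ (z + z'))// ltW// addr_gt0.
  have h2 : 2 <= k^-1 * (z + z') by rewrite mulrC ler_pdivlMr//; lra.
  apply: le_trans zz' _; rewrite (_ : 2 * D * M = D * M * 2); last by ring.
  by rewrite -[leRHS]mulrA; apply: ler_wpM2l => //; exact: mulr_ge0.
have -> : a / z - b / z' = (a - b) / z + b * (z' - z) / (z * z').
  by field; rewrite !gt_eqF.
have kV x : k <= x -> `|x^-1| <= k^-1.
  move=> kx; have x0 := lt_le_trans k0 kx.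
  by rewrite ger0_norm ?invr_ge0 ?(ltW x0)// lef_pV2.
apply: le_trans (ler_normD _ _) _; rewrite [leRHS]mulrDl; apply: lerD.
  by rewrite normrM mulrC; apply: ler_pM => //; exact: kV.
have -> : M * k^-1 ^+ 3 * D = 1 * (D * M * k^-1) * (k^-1 * k^-1) by ring.
rewrite normrM invfM !normrM; apply: ler_pM; rewrite ?mulr_ge0//.
  by apply: ler_pM => //; rewrite ger0_norm.
by apply: ler_pM => //; exact: kV.
Qed.

Section posterior.
Context d (T : measurableType d) (R : realType).
Variables (mu : {finite_measure set T -> \bar R}) (n : nat) (S : 'M[R]_n).
Variable G : T -> 'cV[R]_n.
Hypothesis mG : forall i, measurable_fun setT (fun u => G u i 0).

(** The square root of the likelihood, so that the evidence is the integral of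
    its square. *)
Let g (delta : 'cV[R]_n) u := gauss (norm_cov S (delta - G u)).
Let Z delta := evidence mu S G delta.
Let M := fine (mu setT).

Lemma norm_cov_ge0 v : 0 <= norm_cov S v.
Proof. exact: enorm_ge0. Qed.

Lemma norm_cov_dist v w : `|norm_cov S v - norm_cov S w| <= norm_cov S (v - w).
Proof. by rewrite /norm_cov mulmxBr enorm_dist. Qed.

Lemma measurable_misfit delta :
  measurable_fun setT (fun u => norm_cov S (delta - G u)).
Proof.
apply: measurable_enorm => i j; rewrite (ord1 j).
under eq_fun do rewrite mxE.
apply: measurable_sum => k; apply: measurable_funM => //.
under eq_fun do rewrite !mxE.
by apply: measurable_funB => //; exact: mG.
Qed.

Lemma bounded_finite_integrable (h : T -> R) (c : R) : measurable_fun setT h ->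
  (forall u, `|h u| <= c) -> mu.-integrable setT (EFin \o h).
Proof.
move=> mh hc.
have cst_int := finite_measure_integrable_cst mu c measurableT.
apply: (le_integrable measurableT _ _ cst_int); first exact/measurable_EFinP.
by move=> u _ /=; rewrite lee_fin (le_trans (hc u))// ler_norm.
Qed.

Let measurable_g delta : measurable_fun setT (g delta).
Proof.
apply: measurableT_comp; last exact: measurable_misfit.
apply: measurableT_comp => //; apply: measurableT_comp => //.
by apply: measurable_funM => //; exact: measurable_funX.
Qed.

Let measurable_g2 delta : measurable_fun setT (fun u => g delta u ^+ 2).
Proof. exact: measurable_funX. Qed.

Let g_ge0 delta u : 0 <= g delta u. Proof. exact/ltW/gauss_gt0. Qed.

Let g_le1 delta u : g delta u <= 1. Proof. exact: gauss_le1. Qed.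

Let g2_le1 delta u : `|g delta u ^+ 2| <= 1.
Proof. by rewrite ger0_norm ?sqr_ge0// exprn_ile1. Qed.

Let integrable_g2 delta :
  mu.-integrable setT (EFin \o (fun u => g delta u ^+ 2)).
Proof.
exact: bounded_finite_integrable (measurable_g2 delta) (g2_le1 delta).
Qed.

Let potentialE delta u : expR (- potential S G u delta) = g delta u ^+ 2.
Proof. by rewrite /g gauss_sqr. Qed.

Let ZE delta : Z delta = \int[mu]_u (g delta u ^+ 2).
Proof.
by rewrite /Z /evidence; apply: eq_Rintegral => u _; rewrite potentialE.
Qed.

Let g_lipschitz delta delta' u :
  `|g delta u - g delta' u| <= norm_cov S (delta - delta').
Proof.
apply: le_trans (gauss_lipschitz (norm_cov_ge0 _) (norm_cov_ge0 _)) _.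
apply: le_trans (norm_cov_dist _ _) _.
by rewrite opprB addrA subrK.
Qed.

Let M_ge0 : 0 <= M. Proof. by rewrite fine_ge0. Qed.

Let le_Rintegral_cst (h : T -> R) (c : R) : measurable_fun setT h ->
  (forall u, 0 <= h u <= c) -> \int[mu]_u h u <= c * M.
Proof.
move=> mh hc; rewrite -Rintegral_cst//; apply: le_Rintegral => //.
- apply: (@bounded_finite_integrable h c) => // u.
  by have /andP[h0 ?] := hc u; rewrite ger0_norm.
- exact: finite_measure_integrable_cst.
- by move=> u _; have /andP[] := hc u.
Qed.

(** The integrand is g ^ 2, and |g ^ 2 - g' ^ 2| = |g - g'| |g + g'| with g and
    g' at most 1. *)
Lemma evidence_lipschitz delta delta' :
  `|Z delta - Z delta'| <= 2 * norm_cov S (delta - delta') * M.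
Proof.
rewrite !ZE -RintegralB//; apply: le_trans (le_normr_Rintegral _ _) _ => //.
  by have := integrableB measurableT (integrable_g2 delta)
    (integrable_g2 delta').
apply: le_Rintegral_cst => [|u].
  by apply: measurableT_comp => //; exact: measurable_funB.
have g2 : `|g delta u + g delta' u| <= 2.
  by rewrite ger0_norm ?addr_ge0// [leRHS]mulr2n lerD.
rewrite normr_ge0/= subr_sqr normrM mulrC.
by apply: ler_pM => //; exact: g_lipschitz.
Qed.

(** Bounded data have misfit at most K + a, where a is the covariance norm of
    G u, so the likelihood is at least exp (- K ^ 2) exp (- a ^ 2) by
    (K + a) ^ 2 <= 2 K ^ 2 + 2 a ^ 2. The second factor does not depend on the
    data, and its integral is positive because it is positive everywhere. *)
Lemma evidence_lower_bound (r : R) : (0 < mu setT)%E -> 0 <= r ->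
  exists2 m, 0 < m & forall delta, enorm delta < r -> m <= Z delta.
Proof.
move=> mu0 r0; pose K := enorm (invmx (sqrtmx S)) * r.
pose h u := expR (- norm_cov S (- G u) ^+ 2).
have mh : measurable_fun setT h.
  apply: measurableT_comp => //; apply: measurableT_comp => //.
  apply: measurable_funX.
  have := measurable_misfit 0.
  by under eq_fun do rewrite sub0r.
have h01 u : 0 <= h u <= 1.
  by rewrite expR_ge0 -expR0 ler_expR oppr_le0 sqr_ge0.
have ih : mu.-integrable setT (EFin \o h).
  apply: (@bounded_finite_integrable h 1) => // u.
  by have /andP[h0 ?] := h01 u; rewrite ger0_norm.
exists (expR (- K ^+ 2) * \int[mu]_u h u).
  rewrite mulr_gt0 ?expR_gt0//.
  rewrite lt_neqAle Rintegral_ge0 ?andbT//; last by move=> u _; exact: expR_ge0.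
  apply/eqP => h0.
  have : (\int[mu]_u `|(EFin \o h) u| = 0)%E.
    under eq_integral do rewrite /= ger0_norm ?expR_ge0//.
    by rewrite -[LHS]fineK ?integrable_fin_num// -/(Rintegral _ _ _) -h0.
  move/(ae_eq_integral_abs mu measurableT); case; first exact/measurable_EFinP.
  move=> N [mN N0 hN]; move: mu0; suff -> : mu setT = 0%E by rewrite ltxx.
  rewrite -N0; congr (mu _); apply/esym; rewrite -subTset => u _.
  apply: hN => /=; by move=> /(_ I) [] /eqP; rewrite gt_eqF// expR_gt0.
move=> delta dr; rewrite ZE -RintegralZl//; apply: le_Rintegral => //.
  exact: (integrableZl measurableT (expR (- K ^+ 2)) ih).
move=> u _; rewrite gauss_sqr /h -expRD ler_expR.
have : norm_cov S (delta - G u) <= K + norm_cov S (- G u).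
  rewrite /norm_cov mulmxDr; apply: le_trans (enormD _ _) _; rewrite lerD2r.
  apply: le_trans (enormM _ _) _; rewrite ler_wpM2l ?enorm_ge0// ltW//.
have := norm_cov_ge0 (delta - G u); have := norm_cov_ge0 (- G u).
move: (norm_cov S (delta - G u)) (norm_cov S (- G u)) => b a a0 b0 bK.
have b2 : b ^+ 2 <= (K + a) ^+ 2 by apply: lerXn2r => //; exact: le_trans b0 bK.
by have := sqr_ge0 (K - a); nra.
Qed.

Let f delta u := (Z delta)^-1 * expR (- potential S G u delta).

Let f_ge0 delta u : 0 <= f delta u.
Proof.
rewrite mulr_ge0 ?expR_ge0// invr_ge0 ZE Rintegral_ge0// => x _.
exact: sqr_ge0.
Qed.

Let measurable_f delta : measurable_fun setT (f delta).
Proof.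
by rewrite /f; under eq_fun do rewrite potentialE; exact: measurable_funM.
Qed.

Let integral_f delta : 0 < Z delta -> (\int[mu]_u (f delta u)%:E = 1)%E.
Proof.
move=> Z0; rewrite /f; under eq_integral do rewrite potentialE EFinM.
rewrite ge0_integralZl//; last 3 first.
- exact/measurable_EFinP.
- by move=> u _; rewrite lee_fin sqr_ge0.
- by rewrite lee_fin invr_ge0 ltW.
rewrite -[X in (_ * X)%E]fineK; last exact/integrable_fin_num/integrable_g2.
by rewrite -/(Rintegral _ _ _) -ZE -EFinM mulVf// gt_eqF.
Qed.

Let sqrt_f delta u : Num.sqrt (f delta u) = g delta u / Num.sqrt (Z delta).
Proof.
rewrite /f potentialE mulrC sqrtrM ?sqr_ge0// sqrtrV; last first.
  by rewrite ZE Rintegral_ge0// => x _; exact: sqr_ge0.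
by rewrite sqrtr_sqr ger0_norm// ltW// gauss_gt0.
Qed.

Lemma sqrt_density_lipschitz (m : R) delta delta' u : 0 < m ->
  m <= Z delta -> m <= Z delta' ->
  `|Num.sqrt (f delta u) - Num.sqrt (f delta' u)| <=
  ((Num.sqrt m)^-1 + M * (Num.sqrt m)^-1 ^+ 3) * norm_cov S (delta - delta').
Proof.
move=> m0 mZ mZ'.
have E := congr2 (fun x y => x - y) (sqrt_f delta u) (sqrt_f delta' u).
rewrite [X in `|X|]E.
have := g_le1 delta' u; have := g_ge0 delta' u.
have := g_lipschitz delta delta' u; have := evidence_lipschitz delta delta'.
have := norm_cov_ge0 (delta - delta').
move: (norm_cov S (delta - delta')) (g delta u) (g delta' u) => D a b.
move: (Z delta) (Z delta') mZ mZ' => z z' mz mz' D0 zz' ab b0 b1.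
have z0 := lt_le_trans m0 mz; have z'0 := lt_le_trans m0 mz'.
apply: quotient_lipschitz => //; first by rewrite sqrtr_gt0.
- by rewrite ler_sqrt// ltW.
- by rewrite ler_sqrt// ltW.
- by rewrite !sqr_sqrtr ?(ltW z0) ?(ltW z'0).
Qed.

(** The square roots of the densities are uniformly close, and the total mass
    is finite, so they are close in mean square. *)
Lemma hellinger_posterior_lipschitz (r : R) : 0 < r ->
  exists C : R, 0 < C /\
    forall delta delta' : 'cV[R]_n, enorm delta < r -> enorm delta' < r ->
      hellinger mu (posterior mu S G delta) (posterior mu S G delta') <=
      C * norm_cov S (delta - delta').
Proof.
move=> r0.
(* If the base measure is zero, so is the integral defining the distance. *)
have [mu0|mu0] := eqVneq (mu setT) 0%E.
  exists 1; split => // delta delta' _ _; rewrite mul1r.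
  rewrite (le_trans _ (norm_cov_ge0 _))// /hellinger /Rintegral.
  rewrite (eq_measure_integral mzero); last first.
    move=> A mA _; apply/eqP; rewrite /mzero -measure_le0 -mu0.
    by rewrite le_measure// inE.
  by rewrite integral_measure_zero mulr0 sqrtr0.
have {}mu0 : (0 < mu setT)%E by rewrite lt_neqAle eq_sym mu0 measure_ge0.
have [m m0 mZ] := evidence_lower_bound mu0 (ltW r0).
pose C0 := (Num.sqrt m)^-1 + M * (Num.sqrt m)^-1 ^+ 3.
have C00 : 0 < C0.
  by rewrite ltr_pwDl ?invr_gt0 ?sqrtr_gt0// mulr_ge0// exprn_ge0// invr_ge0
    sqrtr_ge0.
(* The summand 1 only makes the constant visibly positive. *)
exists (Num.sqrt (2^-1 * M) * C0 + 1); split.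
  by rewrite ltr_wpDl// mulr_ge0 ?sqrtr_ge0// ltW.
move=> delta delta' dr d'r; set D := norm_cov S _.
have D0 : 0 <= D := norm_cov_ge0 _.
have f1 := integral_f (lt_le_trans m0 (mZ _ dr)).
have f1' := integral_f (lt_le_trans m0 (mZ _ d'r)).
apply: (@le_trans _ _ (Num.sqrt (2^-1 * M) * C0 * D)); last first.
  by rewrite ler_wpM2r// lerDl.
have -> : Num.sqrt (2^-1 * M) * C0 * D = Num.sqrt (2^-1 * ((C0 * D) ^+ 2 * M)).
  rewrite [in RHS]mulrCA [in RHS]sqrtrM ?sqr_ge0// sqrtr_sqr.
  rewrite ger0_norm ?(mulr_ge0 (ltW C00))//.
  by rewrite [RHS]mulrC mulrA.
have hE : hellinger mu (posterior mu S G delta) (posterior mu S G delta') = _ :=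
  hellinger_densityE (f_ge0 delta) (measurable_f delta) f1
    (f_ge0 delta') (measurable_f delta') f1'.
rewrite {}hE.
apply: ler_wsqrtr; apply: ler_wpM2l; first by rewrite invr_ge0.
apply: le_Rintegral_cst => [|u].
  apply: measurable_funX; apply: measurable_funB; apply: measurableT_comp => //;
    by apply: continuous_measurable_fun; exact: sqrt_continuous.
rewrite sqr_ge0/= -[leLHS]real_normK ?num_real//.
apply: lerXn2r; rewrite ?nnegrE ?mulr_ge0 ?(ltW C00)//.
by apply: sqrt_density_lipschitz m0 (mZ _ dr) (mZ _ d'r).
Qed.

End posterior.

Theorem proposition2p5 (R : realType) (d : nat)
  (Omega : set 'rV[R]_d.+1) (x0 : 'rV[R]_d.+1)
  (s_star s_bar : 'rV[R]_d.+1 -> R) (psi : nat -> 'rV[R]_d.+1 -> R)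
  (c p : R) (s : 'rV[R]_d.+1 -> Uspace Omega psi -> R)
  (gamma0 : probability (Rinfty R) R)
  (N : nat) (xs : 'I_N -> 'rV[R]_d.+1) (Sigma : 'M[R]_N) :
  bounded_lipschitz_domain Omega ->
  Omega x0 ->
  Linfty Omega s_star ->
  Linfty Omega s_bar ->
  (forall i, Linfty Omega (psi i)) ->
  {ae @lebesgue_rV R d, forall x, Omega x -> 0 <= s_star x} ->
  0 < c ->
  1 < p ->
  (* psi i stands for the function with index i + 1 *)
  (forall i, Linfty_norm Omega (psi i) < c * i.+1%:R `^ (- p)) ->
  (forall u, {ae @lebesgue_rV R d, forall x, Omega x ->
     s x u = s_star x +
       expR (s_bar x + limn (series (fun i => coeff u i * psi i x)))}) ->
  (forall u, {within closure Omega, continuous (s ^~ u)}) ->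
  (forall u x, closure Omega x -> 0 < s x u) ->
  standard_gaussian_product gamma0 ->
  (forall j, closure Omega (xs j)) ->
  posdefmx Sigma ->
  let gamma : {finite_measure set (Uspace Omega psi) -> \bar R} :=
    prior gamma0 in
  let T x u := travel_time Omega x0 (s ^~ u) x in
  let G u : 'cV[R]_N := \col_j T (xs j) u in
  forall r : R, 0 < r ->
  exists C : R, 0 < C /\
    forall delta delta' : 'cV[R]_N, enorm delta < r -> enorm delta' < r ->
      hellinger gamma (posterior gamma Sigma G delta)
        (posterior gamma Sigma G delta') <=
      C * norm_cov Sigma (delta - delta').
Proof.
move=> [oO _ _ _] _ _ _ psiL star0 _ _ _ sE sc s0 _ _ _ gamma T G r r0.
apply: hellinger_posterior_lipschitz r0 => j.
have -> : (fun u => G u j 0) = T (xs j) by apply/funext => u; rewrite mxE.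
have s_ratio := slowness_ratio oO psiL star0 sE sc.
apply: measurable_ratio_lipschitz => [u|u v].
  by apply: travel_time_ge0 => y; exact: s0.
apply: travel_time_ratio;
  [exact: expR_gt0|exact: sc|exact: sc|exact: s0|exact: s0| |].
  by move=> y Oy; exact: s_ratio.
by move=> y Oy; rewrite /udist wdistC; exact: s_ratio.
Qed.
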